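(* Let $(W,\Sigma)$ be a Coxeter system, $Q=(\sigma_1,\ldots,\sigma_n)$ a word in $W$ (with $\sigma_i\in\Sigma$), $\pi\in W$, and let $\Delta$ be the subword complex $\Delta(Q,\pi)$. Let $k$ be a field. Then the Stanley--Reisner ideal $I_{\Delta^\vee}\subset k[x_1,\ldots,x_n]$ of the Alexander dual of $\Delta$ has linear quotients with respect to the lexicographical order of its minimal monomial generators; that is, if $G(I_{\Delta^\vee})=\{\mathbf x_{P_1},\ldots,\mathbf x_{P_r}\}$ with $\mathbf x_{P_1}>_{lex}\cdots>_{lex}\mathbf x_{P_r}$, then for every $2\le i\le r$ the colon ideal $(\mathbf x_{P_1},\ldots,\mathbf x_{P_{i-1}}):\mathbf x_{P_i}$ is generated by a subset of the variables.
   Context: $\Sigma$ is the set of simple reflections of the Coxeter group $W$ and $\ell$ the length function. A word $Q=(\sigma_1,\ldots,\sigma_n)$ of size $n$ is an ordered sequence of elements of $\Sigma$; a subword $P=(\sigma_{i_1},\ldots,\sigma_{i_m})$, $i_1<\cdots<i_m$, is an ordered subsequence (identified with its set of positions $\{i_1,\ldots,i_m\}\subseteq\{1,\ldots,n\}$). $P$ represents $\pi$ if the ordered product of the simple reflections in $P$ is a reduced expression for $\pi$; $P$ contains $\pi$ if some subsequence of $P$ represents $\pi$. The subword complex $\Delta(Q,\pi)$ is the set of subwords $Q\setminus P$ such that $P$ contains $\pi$; it is a pure simplicial complex on (positions) $\{1,\ldots,n\}$ whose facets are the $Q\setminus P$ with $P$ representing $\pi$. For a subword $P=(\sigma_{i_1},\ldots,\sigma_{i_m})$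 put $\mathbf x_P=x_{i_1}\cdots x_{i_m}$. The Stanley--Reisner ideal of the Alexander dual is $I_{\Delta^\vee}=(\mathbf x_P: P\subseteq Q,\ P\text{ represents }\pi)$, and $G(I_{\Delta^\vee})$ is its minimal monomial generating set. The lexicographic order is taken with $x_1>\cdots>x_n$. *)

(* Defs.v *)
From mathcomp Require Import all_boot all_order all_algebra.
From mathcomp Require Export mpoly.

Set Implicit Arguments.
Unset Strict Implicit.
Unset Printing Implicit Defensive.

Import GRing.Theory.
Local Open Scope ring_scope.

(** * Group presentations and Coxeter systems *)

Section Presentation.

Variables (X : Type) (W : groupType) (f : X -> W) (rel : seq (X * bool) -> Prop).

(* The letter (x, false) stands for x and (x, true) for its formal inverse. *)
Definition letter_val (l : X * bool) : W := (if l.2 then (f l.1)^-1 else f l.1)%g.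

Definition gword_val (w : seq (X * bool)) : W := (\prod_(l <- w) letter_val l)%g.

(* Equality of words in < X | rel >: the free group modulo the normal closure
   of the relators. *)
Inductive pres_eq : seq (X * bool) -> seq (X * bool) -> Prop :=
| pres_refl u : pres_eq u u
| pres_sym u v : pres_eq u v -> pres_eq v u
| pres_trans u v w : pres_eq u v -> pres_eq v w -> pres_eq u w
| pres_cancel u x b v : pres_eq (u ++ [:: (x, b); (x, ~~ b)] ++ v) (u ++ v)
| pres_relator u r v : rel r -> pres_eq (u ++ r ++ v) (u ++ v).

(* The map X -> W induces an isomorphism from < X | rel > onto W. *)
Definition presents : Prop :=
  (forall g : W, exists w, gword_val w = g) /\
  (forall u v, gword_val u = gword_val v <-> pres_eq u v).

End Presentation.

(* The entry 0 encodes infinity, so off-diagonal entries are infinite or at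
   least 2. *)
Definition Coxeter_matrix (X : eqType) (m : X -> X -> nat) : Prop :=
  (forall s t, m s t = m t s) /\ (forall s t, (m s t == 1%N) = (s == t)).

Definition Coxeter_relator (X : Type) (m : X -> X -> nat)
    (w : seq (X * bool)) : Prop :=
  exists s t, (0 < m s t)%N /\
    w = flatten (nseq (m s t) [:: (s, false); (t, false)]).

Definition Coxeter_system (W : groupType) (Sigma : {pred W}) : Prop :=
  exists m : {s : W | s \in Sigma} -> {s : W | s \in Sigma} -> nat,
    Coxeter_matrix m /\
    presents (fun s : {s : W | s \in Sigma} => val s) (Coxeter_relator m).

(** * Subword complexes *)

Section Subword.

Variables (W : groupType) (Sigma : {pred W}).

Definition expression (w : seq W) (g : W) : Prop :=
  {subset w <= Sigma} /\ (\prod_(s <- w) s)%g = g.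

Definition reduced_expression (w : seq W) (g : W) : Prop :=
  expression w g /\ forall w', expression w' g -> (size w <= size w')%N.

Variables (n : nat) (Q : n.-tuple W) (pi : W).

(* A subword is given by its set of positions; enum lists these in increasing
   order. *)
Definition subword (P : {set 'I_n}) : seq W := [seq tnth Q i | i <- enum P].

Definition represents (P : {set 'I_n}) : Prop :=
  reduced_expression (subword P) pi.

Definition contains (P : {set 'I_n}) : Prop :=
  exists2 P' : {set 'I_n}, P' \subset P & represents P'.

Definition subword_complex (F : {set 'I_n}) : Prop :=
  exists2 P : {set 'I_n}, contains P & F = ~: P.

End Subword.

(** * Ideals *)

Section Ideals.

Variable R : comNzRingType.

Definition ideal_gen (A : R -> Prop) (p : R) : Prop :=
  exists2 cs : seq (R * R),
    forall c, c \in cs -> A c.2 & p = \sum_(c <- cs) c.1 * c.2.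

Definition colon (J : R -> Prop) (f : R) (p : R) : Prop := J (p * f).

End Ideals.

Definition Alexander_dual (n : nat) (Delta : {set 'I_n} -> Prop)
    (F : {set 'I_n}) : Prop := ~ Delta (~: F).

Section MonomialIdeals.

Variables (k : fieldType) (n : nat).

Definition SR_ideal (Delta : {set 'I_n} -> Prop) : {mpoly k[n]} -> Prop :=
  ideal_gen (fun q => exists2 F : {set 'I_n},
    ~ Delta F & q = \prod_(i in F) 'X_i).

Definition mon_ideal (G : seq 'X_{1..n}) : {mpoly k[n]} -> Prop :=
  ideal_gen (fun q => exists2 m, m \in G & q = 'X_[m]).

Definition var_ideal (V : {set 'I_n}) : {mpoly k[n]} -> Prop :=
  ideal_gen (fun q => exists2 i, i \in V & q = 'X_i).

Definition minimal_mon_generators (I : {mpoly k[n]} -> Prop)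
    (G : seq 'X_{1..n}) : Prop :=
  (forall p, mon_ideal G p <-> I p) /\
  forall G' : seq 'X_{1..n}, {subset G' <= G} ->
    (forall p, mon_ideal G' p <-> I p) -> {subset G <= G'}.

(* The variable with the smallest index is the largest. *)
Definition lex_gt (m1 m2 : 'X_{1..n}) : bool :=
  [exists i : 'I_n, (m2 i < m1 i)%N &&
     [forall j : 'I_n, (j < i)%N ==> (m1 j == m2 j)]].

(* Positions are counted from 0. *)
Definition linear_quotients (G : seq 'X_{1..n}) : Prop :=
  forall i, (0 < i < size G)%N ->
    exists V : {set 'I_n}, forall p,
      colon (mon_ideal (take i G)) 'X_[nth 0%MM G i] p <-> var_ideal V p.

End MonomialIdeals.

Arguments SR_ideal k {n} Delta p.
Arguments mon_ideal k {n} G p.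
Arguments var_ideal k {n} V p.

(* Main.v *)
(* Minimal generators of the dual ideal are the x_P with P representing pi.
   Suppose x_{P'} > x_P in the lexicographic order, and let t be the first
   position where P and P' differ, so that t lies in P' but not in P.  Cancelling
   the common prefix, the exchange condition applied to the letter at t yields
   some s > t in P such that P + t - s represents pi.  Its monomial is again
   lexicographically larger than x_P, and divides x_t x_P; hence the colon ideal
   is generated by variables.

   The exchange condition is derived from the presentation: the parity of the
   number of times a reflection r equals s_1 ... s_i ... s_1 along a word
   s_1 ... s_q does not change under the Coxeter relations, so it depends only on
   the product of the word. *)
Require Import Defs.
From mathcomp Require Import all_boot all_order all_algebra.
From Stdlib Require Import Classical.

Set Implicit Arguments.
Unset Strict Implicit.
Unset Printing Implicit Defensive.

Lemma size_delete (T : Type) (w : seq T) i :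
  i < size w -> (size (take i w ++ drop i.+1 w)).+1 = size w.
Proof.
by move=> ltiw; rewrite size_cat size_take ltiw size_drop -addSn subnKC.
Qed.

(** * Reflections met along a word, counted modulo 2 *)

Section ReflectionParity.

Variable W : groupType.
Implicit Types (u v w : seq W) (r s : W).
Local Open Scope group_scope.

(** Conjugating [r] by each letter read, instead of storing the prefix, makes the test at the i-th
    letter say that [r] is that letter conjugated by the prefix before it. *)
Fixpoint reflection_parity w r : bool :=
  if w is s :: w' then (s == r) (+) reflection_parity w' (r ^ s) else false.

Lemma reflection_parity_cat u v r :
  reflection_parity (u ++ v) r =
  reflection_parity u r (+) reflection_parity v (r ^ (\prod_(s <- u) s)).
Proof.
elim: u r => [|s u IH] r /=; first by rewrite big_nil conjg1.
by rewrite IH big_cons conjgM addbA.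
Qed.

Lemma conjg_eq_invol s t r : s * s = 1 -> (r ^ s == t) = (r == s * t * s).
Proof.
move=> ss; have sV : s^-1 = s by rewrite -[LHS]mulg1 -ss mulKg.
rewrite conjgE sV; apply/eqP/eqP=> [<-|->]; rewrite !mulgA ss mul1g -!mulgA ss.
  by rewrite mulg1.
by rewrite mulg1.
Qed.

(* The reflections met along (s t)^k are the (s t)^j s for j < 2k. *)
Lemma reflection_parity_dihedral s t (k : nat) r :
  s * s = 1 -> t * t = 1 ->
  reflection_parity (flatten (nseq k [:: s; t])) r =
  odd (count (fun j => r == (s * t) ^+ j * s) (iota 0 k.*2)).
Proof.
move=> ss tt; elim: k r => [|k IH] r //=.
rewrite IH (iotaDl 2 0) count_map !oddD !oddb expg0 mul1g expg1.
rewrite [s == r]eq_sym [t == _]eq_sym conjg_eq_invol //.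
congr (_ (+) (_ (+) odd _)); apply: eq_count => j /=.
by rewrite !conjg_eq_invol // expgS expgSr !mulgA.
Qed.

(** Since [(s * t) ^+ m = 1], the list of 2m reflections repeats its first half in its second, so
    every count is even. *)
Lemma reflection_parity_relator s t (m : nat) r :
  s * s = 1 -> t * t = 1 ->
  \prod_(x <- flatten (nseq m [:: s; t])) x = 1 ->
  reflection_parity (flatten (nseq m [:: s; t])) r = false.
Proof.
move=> ss tt; have -> : \prod_(x <- flatten (nseq m [:: s; t])) x = (s * t) ^+ m.
  elim: m => [|m IH] /=; first by rewrite big_nil.
  by rewrite !big_cons IH expgS mulgA.
move=> stm; rewrite reflection_parity_dihedral // -addnn iotaD count_cat.
rewrite [(0 + m)%N]addnC iotaDl count_map oddD addbC.
rewrite [X in odd X (+) _](_ : _ = count (fun j => r == (s * t) ^+ j * s) (iota 0 m)).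
  by rewrite addbb.
by apply: eq_count => j /=; rewrite expgnDr stm mul1g.
Qed.

(** Odd parity gives at least one position where [r] is the letter conjugated by the prefix before
    it; left multiplication by such an [r] erases that letter. *)
Lemma reflection_parityP w r : {in w, forall s, s * s = 1} ->
  reflection_parity w r ->
  exists2 i, (i < size w)%N &
    \prod_(s <- take i w ++ drop i.+1 w) s = r * \prod_(s <- w) s.
Proof.
elim: w r => [|s w IH] r //= invol.
case: eqP => [<- _|_] /=.
  exists 0%N => //=.
  by rewrite drop0 big_cons mulgA invol ?mem_head // mul1g.
case/IH => [x xw|i lti E]; first by rewrite invol // inE xw orbT.
by exists i.+1 => //=; rewrite !big_cons E conjgE !mulgA mulgV mul1g.
Qed.

(** A shorter expression of the suffix would shorten the whole word. This keeps reducedness when a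
    common prefix is cancelled. *)
Lemma reduced_expression_suffix (Sigma : {pred W}) u v g :
  reduced_expression Sigma (u ++ v) g ->
  reduced_expression Sigma v (\prod_(s <- v) s).
Proof.
case=> -[sub E] min; split; first by split=> // s sv; apply: sub; rewrite mem_cat sv orbT.
move=> v' [sub' E']; suff: (size (u ++ v) <= size (u ++ v'))%N.
  by rewrite !size_cat leq_add2l.
apply: min; split; last by rewrite big_cat /= E' -E big_cat.
by move=> s; rewrite mem_cat => /orP[su|/sub' //]; apply: sub; rewrite mem_cat su.
Qed.

End ReflectionParity.

(** * The exchange condition from the Coxeter presentation *)

Section CoxeterSystem.

Variables (W : groupType) (Sigma : {pred W}).
Hypothesis coxW : Coxeter_system Sigma.
Implicit Types (u v w : seq W) (r s : W).
Local Open Scope group_scope.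

(** The diagonal entry of the Coxeter matrix at [s] is 1, so the word with letters [s], [s] is
    itself a relator. *)
Lemma Coxeter_generator_invol s : s \in Sigma -> s * s = 1.
Proof.
case: coxW => m [[_ m1] [_ pres]] sS; pose x : {s | s \in Sigma} := exist _ s sS.
suff /pres : pres_eq (Coxeter_relator m) [:: (x, false); (x, false)] [::].
  by rewrite /gword_val !big_cons !big_nil mulg1.
apply: (@pres_relator _ _ [::] [:: (x, false); (x, false)] [::]).
by exists x, x; have /eqP -> : m x x == 1%N by rewrite m1.
Qed.

(** The inversion flag can be forgotten because generators are involutions; words of the
    presentation thus become plain words in [W]. *)
Let generator_val (l : {s | s \in Sigma} * bool) : W := val l.1.

Lemma letter_val_generator l :
  letter_val (fun s : {s | s \in Sigma} => val s) l = generator_val l.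
Proof.
rewrite /letter_val /generator_val; case: l => -[s sS] [] //=.
by rewrite -[LHS]mulg1 -(Coxeter_generator_invol sS) mulKg.
Qed.

Lemma prod_generator_val (a : seq ({s | s \in Sigma} * bool)) :
  \prod_(s <- map generator_val a) s =
  gword_val (fun s : {s | s \in Sigma} => val s) a.
Proof. by rewrite big_map; apply: eq_bigr => l _; rewrite letter_val_generator. Qed.

(** Induction on the derivation. A cancelled pair meets the same reflection twice, and a relator
    meets each one an even number of times. Both have product 1, so the reflections met in the rest
    of the word do not change. *)
Lemma reflection_parity_pres_eq (m : {s | s \in Sigma} -> {s | s \in Sigma} -> nat)
    (a b : seq ({s | s \in Sigma} * bool)) :
  presents (fun s : {s | s \in Sigma} => val s) (Coxeter_relator m) ->
  pres_eq (Coxeter_relator m) a b ->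
  reflection_parity (map generator_val a) =1 reflection_parity (map generator_val b).
Proof.
case=> _ pres.
have inv l : generator_val l * generator_val l = 1.
  exact/Coxeter_generator_invol/valP.
elim=> {a b} [//|a b _ IH r|a b c _ IH1 _ IH2 r|a x e b r|a c b relc r].
- by rewrite IH.
- by rewrite IH1 IH2.
- rewrite !map_cat !reflection_parity_cat /=; congr (_ (+) _).
  set q := r ^ _; set y := generator_val (x, e).
  rewrite -[generator_val (x, ~~ e)]/y !big_cons big_nil mulg1 inv conjg1.
  rewrite [y == q ^ _]eq_sym conjg_eq_invol ?inv // mul1g [q == _]eq_sym.
  by rewrite addbF addbb.
- rewrite !map_cat !reflection_parity_cat.
  have : gword_val (fun s : {s | s \in Sigma} => val s) c =
         gword_val (fun s : {s | s \in Sigma} => val s) [::].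
    by apply/pres; rewrite -[c]cats0; apply: (@pres_relator _ _ [::]).
  rewrite -!prod_generator_val => prodc; rewrite prodc big_nil conjg1.
  case: relc => s [t [_ cE]].
  have cE' : map generator_val c = flatten (nseq (m s t) [:: val s; val t]).
    by rewrite cE map_flatten map_nseq.
  rewrite cE' in prodc *; rewrite reflection_parity_relator //.
  - exact/Coxeter_generator_invol/valP.
  - exact/Coxeter_generator_invol/valP.
  - by rewrite prodc big_nil.
Qed.

Lemma reflection_parity_eq u v :
  {subset u <= Sigma} -> {subset v <= Sigma} ->
  \prod_(s <- u) s = \prod_(s <- v) s ->
  reflection_parity u =1 reflection_parity v.
Proof.
have lift w : {subset w <= Sigma} -> exists a, map generator_val a = w.
  elim: w => [|s w IH] sub; first by exists [::].
  have [x xw|a <-] := IH; first by apply: sub; rewrite inE xw orbT.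
  by exists ((exist _ s (sub s (mem_head _ _)), false) :: a).
move=> /lift[a <-] /lift[b <-] E; case: coxW => m [_ pres].
apply: (reflection_parity_pres_eq pres); apply/pres.2.
by rewrite -!prod_generator_val.
Qed.

(* The reflection s occurs exactly once along the reduced word s :: u, hence an
   odd number of times along v. *)
Lemma exchange s u v g :
  reduced_expression Sigma (s :: u) g -> expression Sigma v g ->
  exists2 i, (i < size v)%N & expression Sigma (s :: take i v ++ drop i.+1 v) g.
Proof.
move=> [[subu prodsu] min] [subv prodv].
have sS : s \in Sigma by apply: subu; rewrite mem_head.
have ss := Coxeter_generator_invol sS.
have invol w : {subset w <= Sigma} -> {in w, forall x, x * x = 1}.
  by move=> sub x /sub; apply: Coxeter_generator_invol.
have subset_del i w : {subset w <= Sigma} -> {subset take i w ++ drop i.+1 w <= Sigma}.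
  by move=> sub x; rewrite mem_cat => /orP[/mem_take|/mem_drop]; apply: sub.
have subu' : {subset u <= Sigma} by move=> x xu; apply: subu; rewrite inE xu orbT.
have : reflection_parity v s.
  rewrite -(reflection_parity_eq subu subv) ?prodv //= eqxx addTb conjgE -?mulgA mulKg.
  (* An occurrence of [s] along [u] would allow a letter of [u] to be erased, expressing [g] by a
     word shorter than [u]. *)
  apply/negP => /(reflection_parityP (invol _ subu'))[i lti E].
  have : (size (s :: u) <= size (take i u ++ drop i.+1 u))%N.
    by apply: min; split; [exact: subset_del | rewrite E -prodsu big_cons].
  by rewrite /= -[size u](size_delete lti) ltnNge leqnSn.
case/(reflection_parityP (invol _ subv)) => i lti E; exists i => //; split.
  by move=> x; rewrite inE => /predU1P[->//|]; apply: subset_del.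
by rewrite big_cons E mulgA ss mul1g.
Qed.

End CoxeterSystem.

(** * Exchange between two subwords of [Q] *)

Section SubwordExchange.

Variables (W : groupType) (Sigma : {pred W}).
Hypothesis coxW : Coxeter_system Sigma.
Variables (n : nat) (Q : n.-tuple W) (pi : W).
Hypothesis QSigma : forall i : 'I_n, tnth Q i \in Sigma.
Implicit Types P : {set 'I_n}.

Lemma enum_setE P : enum P = [seq i <- enum 'I_n | i \in P].
Proof. by rewrite enumT. Qed.

(** Serves to read any subword as its letters before, at and after [t]. *)
Lemma enum_ord_split (t : 'I_n) : exists A B : seq 'I_n,
  [/\ enum 'I_n = A ++ t :: B, {in A, forall j : 'I_n, j < t} &
      {in B, forall j : 'I_n, t < j}].
Proof.
have : sorted ltn (map val (enum 'I_n)) by rewrite val_enum_ord iota_ltn_sorted.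
have /splitPr : t \in enum 'I_n by rewrite mem_enum.
case=> A B; rewrite map_cat /= sorted_pairwise; last exact: ltn_trans.
rewrite pairwise_cat /= => /and4P[/allrelP AB _ /allP tB _].
exists A, B; split=> // j jX; last by apply: tB; rewrite map_f.
by apply: AB; rewrite ?map_f ?mem_head.
Qed.

Lemma subword_subset P : {subset subword Q P <= Sigma}.
Proof. by move=> _ /mapP[i _ ->]. Qed.

Lemma represents_exchange P P' (t : 'I_n) :
  represents Sigma Q pi P -> represents Sigma Q pi P' ->
  t \in P' -> t \notin P -> (forall j : 'I_n, j < t -> (j \in P) = (j \in P')) ->
  exists s : 'I_n, [/\ s \in P, t < s & represents Sigma Q pi (t |: P :\ s)].
Proof.
have [A [B [enumE ltA gtB]]] := enum_ord_split t.
have uniqAB : uniq (A ++ t :: B) by rewrite -enumE enum_uniq.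
pose word (D : seq 'I_n) := map (tnth Q) D.
have subwordE P0 : subword Q P0 = word [seq i <- A | i \in P0] ++
    (if t \in P0 then [:: tnth Q t] else [::]) ++ word [seq i <- B | i \in P0].
  rewrite /subword enum_setE enumE filter_cat map_cat /=.
  by case: ifP.
move=> repP repP' tP' tP PP'.
have AE : [seq i <- A | i \in P'] = [seq i <- A | i \in P].
  by apply: eq_in_filter => j /ltA/PP' ->.
set a := word [seq i <- A | i \in P].
set D := [seq i <- B | i \in P].
have PE : subword Q P = a ++ word D by rewrite subwordE (negPf tP).
have P'E : subword Q P' = a ++ tnth Q t :: word [seq i <- B | i \in P'].
  by rewrite subwordE tP' AE.
have [[subP prodP] minP] := repP.
have [[_ prodP'] _] := repP'.
rewrite /represents P'E in repP' prodP'.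
have redP' := reduced_expression_suffix repP'.
(* Past the common prefix [a], both subwords have the same product. The rest of [P'] is reduced and
   begins with the letter at [t]; the rest of [P] is [word D], which loses a letter. *)
have [|i ltiD [_ E]] := exchange coxW redP' (v := word D).
  split; first by move=> _ /mapP[i _ ->].
  by apply: (@mulgI _ (\prod_(s <- a) s)%g); rewrite -!big_cat /= -PE prodP prodP'.
rewrite size_map in ltiD.
pose s := nth t D i; have sD : s \in D by apply: mem_nth.
have /andP[sP sB] : (s \in P) && (s \in B) by rewrite -mem_filter.
exists s; split=> //; first exact: gtB.
have newE : subword Q (t |: P :\ s) =
    a ++ tnth Q t :: (take i (word D) ++ drop i.+1 (word D)).
  rewrite subwordE !inE eqxx /= /a; congr (word _ ++ _ :: _).
    apply: eq_in_filter => j /ltA ltjt; rewrite !inE.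
    have -> : j == t = false by apply/negbTE; rewrite neq_ltn ltjt.
    have -> // : j == s = false.
    by apply/negbTE; rewrite neq_ltn (ltn_trans ltjt (gtB _ sB)).
  rewrite -map_take -map_drop -map_cat; congr word.
  have uniqD : uniq D.
    by apply: filter_uniq; move: uniqAB; rewrite cat_uniq /= => /and4P[].
  (* No position is repeated in [D], so erasing the entry of index [i] amounts to filtering out the
     value [s]. *)
  transitivity (rem s D).
    rewrite rem_filter // -filter_predI; apply: eq_in_filter => j /gtB gtjt.
    rewrite !inE; have -> // : j == t = false.
    by apply/negbTE; rewrite neq_ltn gtjt orbT.
  by rewrite remE index_uniq.
split; first (split; first exact: subword_subset).
  by rewrite newE big_cat /= E -prodP' big_cat.
(* One letter is added and one erased, so the new word is as long as that of [P], hence also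
   reduced. *)
move=> w /minP; apply: leq_trans.
rewrite newE PE [size (a ++ _ :: _)]size_cat /=.
by rewrite size_delete ?size_cat ?leqnn // size_map.
Qed.

End SubwordExchange.

(** * Membership in monomial ideals, and the lexicographic order *)

Section MonomialIdeals.

Import GRing.Theory.

Variables (k : fieldType) (n : nat).
Implicit Types (m g : 'X_{1..n}) (G : seq 'X_{1..n}) (P F : {set 'I_n}).
Local Open Scope ring_scope.

Lemma ideal_gen_sub (R : comNzRingType) (A B : R -> Prop) p :
  (forall q, A q -> B q) -> ideal_gen A p -> ideal_gen B p.
Proof. by move=> AB [cs csA ->]; exists cs => // c /csA/AB. Qed.

Lemma ideal_gen_sum (R : comNzRingType) (A : R -> Prop) (I : eqType)
    (s : seq I) (F : I -> R) :
  {in s, forall i, ideal_gen A (F i)} -> ideal_gen A (\sum_(i <- s) F i).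
Proof.
elim: s => [|i s IH] AF; first by exists [::]; rewrite ?big_nil.
rewrite big_cons; have [cs csA ->] := IH (fun j js => AF j (mem_behead (s := i :: s) js)).
have [ds dsA ->] := AF i (mem_head _ _).
exists (ds ++ cs); last by rewrite big_cat.
by move=> c; rewrite mem_cat => /orP[/dsA|/csA].
Qed.

(** A monomial in the support of a sum lies in the support of some summand, hence is divisible by a
    generator. Conversely [p] is the sum of its terms, each a multiple of a generator. Since [A] is
    any predicate, this covers lists of monomials, variables and nonfaces alike. *)
Lemma ideal_gen_monP (A : 'X_{1..n} -> Prop) (p : {mpoly k[n]}) :
  ideal_gen (fun q => exists2 m, A m & q = 'X_[m]) p <->
  forall m, m \in msupp p -> exists2 g, A g & (g <= m)%MM.
Proof.
split=> [[cs csA ->] m|suppA].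
  rewrite mcoeff_msupp raddf_sum /=; elim: cs csA => [|c cs IH] csA.
    by rewrite big_nil eqxx.
  rewrite big_cons; have [/eqP c0|c0 _] := boolP ((c.1 * c.2)@_m == 0).
    by rewrite c0 add0r; apply: IH => d dcs; apply: csA; rewrite inE dcs orbT.
  have [g Ag cg] := csA c (mem_head _ _); exists g => //.
  move: c0; rewrite cg -mcoeff_msupp (perm_mem (msuppMX _ _)).
  by case/mapP=> m' _ ->; apply: lem_addr.
rewrite [p]mpolyE; apply: ideal_gen_sum => m /suppA[g Ag gm].
exists [:: (p@_m *: 'X_[m - g], 'X_[g])]; last first.
  by rewrite big_seq1 -scalerAl -mpolyXD submK.
by move=> c; rewrite inE => /eqP ->; exists g.
Qed.

Lemma mon_idealP G (p : {mpoly k[n]}) :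
  mon_ideal k G p <->
  forall m, m \in msupp p -> exists2 g, g \in G & (g <= m)%MM.
Proof. exact: ideal_gen_monP. Qed.

Lemma var_idealP (V : {set 'I_n}) (p : {mpoly k[n]}) :
  var_ideal k V p <->
  forall m, m \in msupp p -> exists2 i, i \in V & (0 < m i)%N.
Proof.
split=> [Vp m mp|suppV].
  have : ideal_gen (fun q : {mpoly k[n]} =>
      exists2 m, (exists2 i, i \in V & m = U_(i)%MM) & q = 'X_[m]) p.
    by apply: ideal_gen_sub Vp => q [i iV ->]; exists U_(i)%MM => //; exists i.
  case/ideal_gen_monP/(_ m mp) => _ [i iV ->] /mnm_lepP/(_ i).
  by rewrite mnm1E eqxx => mi; exists i.
apply: (@ideal_gen_sub _ (fun q => exists2 m, (exists2 i, i \in V & m = U_(i)%MM) & q = 'X_[m])).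
  by move=> q [_ [i iV ->] ->]; exists i.
apply/ideal_gen_monP => m /suppV[i iV mi]; exists U_(i)%MM; first by exists i.
by apply/mnm_lepP=> j; rewrite mnm1E; case: eqP => // <-.
Qed.

Definition mnm_of_set P : 'X_{1..n} := [multinom (i \in P : nat) | i < n].

Lemma mnm_of_set_le P F : (mnm_of_set P <= mnm_of_set F)%MM = (P \subset F).
Proof.
apply/mnm_lepP/subsetP=> [le i iP|sub i].
  by have := le i; rewrite !mnmE iP; case: (i \in F).
by rewrite !mnmE; case: (boolP (i \in P)) => // /sub ->.
Qed.

Lemma mnm_of_set_inj : injective mnm_of_set.
Proof.
move=> P F E; apply/eqP; rewrite eqEsubset -!mnm_of_set_le E.
by rewrite lepm_refl.
Qed.

Lemma prod_mpolyX_set F : \prod_(i in F) 'X_i = 'X_[mnm_of_set F] :> {mpoly k[n]}.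
Proof.
rewrite mpolyXE_id big_mkcond; apply: eq_bigr => i _; rewrite mnmE.
by case: (i \in F); rewrite ?expr1 ?expr0.
Qed.

Lemma lex_gt_irr : irreflexive (@lex_gt n).
Proof. by move=> m; apply/existsP=> -[i]; rewrite ltnn. Qed.

Lemma lex_gt_trans : transitive (@lex_gt n).
Proof.
move=> m2 m1 m3 /existsP[i /andP[lti /forallP eqi]] /existsP[j /andP[ltj /forallP eqj]].
have eqi' (a : 'I_n) : (a < i)%N -> m1 a = m2 a by move=> ai; apply/eqP/(implyP (eqi a)).
have eqj' (a : 'I_n) : (a < j)%N -> m2 a = m3 a by move=> aj; apply/eqP/(implyP (eqj a)).
apply/existsP; case: (ltngtP i j) => [ij|ji|/val_inj ij].
- exists i; rewrite -(eqj' i) // lti /=; apply/forallP=> a; apply/implyP=> ai.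
  by rewrite eqi' // eqj' // (ltn_trans ai).
- exists j; rewrite (eqi' j) // ltj /=; apply/forallP=> a; apply/implyP=> aj.
  by rewrite eqi' ?eqj' // (ltn_trans aj).
- exists i; rewrite (ltn_trans _ lti) ?ij //=; apply/forallP=> a; apply/implyP=> ai.
  by rewrite eqi' ?eqj' // ij.
Qed.

(** Removes list positions from [linear_quotients]: which generators come earlier becomes a
    comparison of monomials. *)
Lemma lex_gt_sorted_mem_take G m i : sorted (@lex_gt n) G -> (i < size G)%N ->
  (m \in take i G) = (m \in G) && lex_gt m (nth 0%MM G i).
Proof.
move=> sG ltiG; have lt_nth := sorted_ltn_nth lex_gt_trans 0%MM sG.
apply/idP/andP=> [mi|[mG gtm]].
  split; first exact: mem_take mi.
  move: (mi); rewrite -index_mem size_take ltiG => ji.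
  rewrite -{1}(nth_index 0%MM mi) nth_take //; apply: lt_nth => //.
  by rewrite inE (ltn_trans ji).
rewrite in_take_leq ?(ltnW ltiG) // ltnNge leq_eqVlt; apply/negP=> /predU1P[ij|ij].
  by move: gtm; rewrite ij nth_index // lex_gt_irr.
have := lt_nth i (index m G) ltiG; rewrite inE index_mem mG => /(_ isT ij).
by rewrite nth_index // => /(lex_gt_trans gtm); rewrite lex_gt_irr.
Qed.

End MonomialIdeals.

(** * Minimal generators of the dual ideal *)

Section SubwordIdeal.

Variables (W : groupType) (Sigma : {pred W}) (n : nat) (Q : n.-tuple W) (pi : W).
Variable k : fieldType.
Local Open Scope ring_scope.

Local Notation I_dual := (SR_ideal k (Alexander_dual (subword_complex Sigma Q pi))).

Lemma SR_ideal_dualP (p : {mpoly k[n]}) :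
  I_dual p <->
  forall m, m \in msupp p ->
    exists2 P, represents Sigma Q pi P & (mnm_of_set P <= m)%MM.
Proof.
(* A nonface of the dual is a doubly negated face condition on the complement of [F]; classical
   logic removes the negations, and complements cancel. *)
have dualP F : ~ Alexander_dual (subword_complex Sigma Q pi) F <->
               contains Sigma Q pi F.
  split=> [/NNPP[P cP /setC_inj ->] //|cF nF].
  by apply: nF; exists F.
pose A m := exists2 F, contains Sigma Q pi F & m = mnm_of_set F.
split=> [Ip m mp|suppP].
  have : ideal_gen (fun q : {mpoly k[n]} => exists2 m, A m & q = 'X_[m]) p.
    apply: ideal_gen_sub Ip => q [F /dualP cF ->].
    by exists (mnm_of_set F); [exists F | rewrite prod_mpolyX_set].
  case/ideal_gen_monP/(_ m mp) => _ [F [P PF repP] ->] Fm; exists P => //.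
  by apply: lepm_trans Fm; rewrite mnm_of_set_le.
apply: (@ideal_gen_sub _ (fun q => exists2 m, A m & q = 'X_[m])).
  by move=> q [_ [F cF ->] ->]; exists F; [apply/dualP | rewrite prod_mpolyX_set].
apply/ideal_gen_monP => m /suppP[P repP Pm]; exists (mnm_of_set P) => //.
by exists P => //; exists P.
Qed.

(** A reduced word is no longer than any other expression of [pi], so nested representing subwords
    have equal size. Hence no generator properly divides another. *)
Lemma represents_subset P P' :
  represents Sigma Q pi P -> represents Sigma Q pi P' -> P \subset P' -> P = P'.
Proof.
move=> [exprP _] [_ min] PP'; apply/eqP; rewrite eqEcard PP' /=.
by have := min _ exprP; rewrite !size_map -!cardE.
Qed.

(** Some [g] in [G] divides the monomial of [P] and is itself divisible by that of some representing
    [P']; then [P'] equals [P], which pins down [g]. Any other member of [G] could be dropped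
    without changing the ideal, against minimality. *)
Lemma minimal_generators_represents G :
  minimal_mon_generators I_dual G ->
  forall m, m \in G <-> exists2 P, represents Sigma Q pi P & m = mnm_of_set P.
Proof.
case=> genG minG.
have suppX m : m \in msupp ('X_[m] : {mpoly k[n]}) by rewrite msuppX inE.
have repG P : represents Sigma Q pi P -> mnm_of_set P \in G.
  move=> repP; have : I_dual 'X_[mnm_of_set P].
    by apply/SR_ideal_dualP => m; rewrite msuppX inE => /eqP ->; exists P; rewrite ?lepm_refl.
  case/genG/mon_idealP/(_ _ (suppX _)) => g gG gP.
  have : I_dual 'X_[g].
    by apply/genG/mon_idealP => m; rewrite msuppX inE => /eqP ->; exists g; rewrite ?lepm_refl.
  case/SR_ideal_dualP/(_ _ (suppX _)) => P' repP' P'g.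
  have EP : P' = P.
    by apply: represents_subset => //; rewrite -mnm_of_set_le (lepm_trans P'g).
  suff <- : g = mnm_of_set P by [].
  by apply/mnmP=> i; apply/eqP; rewrite eqn_leq (mnm_lepP gP) -{1}EP (mnm_lepP P'g).
move=> m; split=> [mG|[P repP ->]]; last exact: repG.
apply: NNPP => notrep.
suff : {subset G <= [seq g <- G | g != m]} by move/(_ m mG); rewrite mem_filter eqxx.
apply: minG => [g|p]; first by rewrite mem_filter => /andP[].
split=> [/mon_idealP Gp|/SR_ideal_dualP Ip].
  by apply/genG/mon_idealP => a /Gp[g]; rewrite mem_filter => /andP[_ gG]; exists g.
apply/mon_idealP => a /Ip[P repP Pa]; exists (mnm_of_set P) => //.
rewrite mem_filter repG // andbT; apply/eqP => Pm; apply: notrep.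
by exists P.
Qed.

End SubwordIdeal.

Theorem theorem4p1p1 (W : groupType) (Sigma : {pred W})
    (coxW : Coxeter_system Sigma)
    (n : nat) (Q : n.-tuple W) (QSigma : forall i : 'I_n, tnth Q i \in Sigma)
    (pi : W) (k : fieldType) (G : seq 'X_{1..n}) :
  minimal_mon_generators
    (SR_ideal k (Alexander_dual (subword_complex Sigma Q pi))) G ->
  sorted (@lex_gt n) G ->
  linear_quotients k G.
Proof.
move=> /minimal_generators_represents memG sG i /andP[_ ltiG].
set g := nth 0%MM G i.
have /memG[P repP gE] : g \in G by apply: mem_nth.
(* All variables whose product with [g] is divisible by an earlier generator: they lie in the colon
   ideal by construction, and the exchange has to show that they generate it. *)
exists [set t : 'I_n | has (fun h => (h <= U_(t) + g)%MM) (take i G)] => p.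
have suppM : msupp (p * 'X_[g])%R =i [seq (g + m)%MM | m <- msupp p].
  exact/perm_mem/msuppMX.
rewrite /colon mon_idealP var_idealP; split=> suppP m mp; last first.
  move: mp; rewrite suppM => /mapP[m' /suppP[t]].
  rewrite inE => /hasP[h hG hle] m't ->; exists h => //.
  apply: lepm_trans hle _; apply/mnm_lepP=> j.
  by rewrite !mnmDE addnC leq_add2l mnm1E; case: eqP => // <-.
have [h hG hle] : exists2 h, h \in take i G & (h <= g + m)%MM.
  by apply: suppP; rewrite suppM map_f.
move: hG; rewrite lex_gt_sorted_mem_take // -/g => /andP[/memG[P' repP' hE]].
rewrite {}hE in hle *; rewrite gE => /existsP[t /andP[]].
rewrite !mnmE => gtt /forallP eqt.
have [tP' tP] : t \in P' /\ t \notin P by move: gtt; case: (t \in P'); case: (t \in P).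
have eqPP' (j : 'I_n) : j < t -> (j \in P) = (j \in P').
  by move=> /(implyP (eqt j)); rewrite !mnmE; case: (j \in P); case: (j \in P').
have [s [sP lts repN]] := represents_exchange coxW QSigma repP repP' tP' tP eqPP'.
(* The variable at [t] divides [m], because it divides the monomial of [P'], hence [g + m], but not
   [g]. *)
exists t; last by move/mnm_lepP/(_ t): hle; rewrite gE mnmDE !mnmE tP' (negPf tP).
rewrite inE; apply/hasP; exists (mnm_of_set (t |: P :\ s)); last first.
  apply/mnm_lepP=> j; rewrite mnmDE mnm1E !mnmE !inE [t == j]eq_sym.
  by case: (j == t); case: (j == s); case: (j \in P).
rewrite lex_gt_sorted_mem_take // -/g; apply/andP; split.
  by apply/memG; exists (t |: P :\ s).
(* As [s] lies after [t], the exchanged set first differs from [P] at [t], which it contains. *)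
rewrite gE; apply/existsP; exists t; rewrite !mnmE !inE eqxx (negPf tP) /=.
apply/forallP=> j; apply/implyP=> jt; rewrite !mnmE !inE.
have -> : j == t = false by apply/negbTE; rewrite neq_ltn jt.
by have -> : j == s = false by apply/negbTE; rewrite neq_ltn (ltn_trans jt lts).
Qed.
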